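(* Let $G_1=(V_1,E_1)$ and $G_2=(V_2,E_2)$ be graphs. Then $\mathrm{thin}(G_1\circ G_2)\leq \mathrm{indthin}(G_1\circ G_2)\leq |V_1|\,\mathrm{indthin}(G_2)$ and $\mathrm{pthin}(G_1\circ G_2)\leq \mathrm{indpthin}(G_1\circ G_2)\leq |V_1|\,\mathrm{indpthin}(G_2)$.
   Context: Graphs are finite, simple, undirected (loopless). The hom-product $G_1\circ G_2$ has vertex set $V_1\times V_2$, and $(u_1,u_2)$, $(v_1,v_2)$ are adjacent iff $u_1\neq v_1$ and either $u_1v_1\notin E_1$ or $u_2v_2\in E_2$. For a graph $G=(V,E)$, an ordering $v_1,\dots,v_n$ of $V$ and a partition of $V$ are consistent if for every $r<s<t$, whenever $v_r,v_s$ are in the same class and $v_tv_r\in E$, then $v_tv_s\in E$; strongly consistent if moreover for every $r<s<t$, whenever $v_s,v_t$ are in the same class and $v_tv_r\in E$, then $v_sv_r\in E$. $\mathrm{thin}(G)$ (resp. $\mathrm{pthin}(G)$) is the minimum number of classes of a partition of $V$ consistent (resp. strongly consistent) with some ordering of $V$; $\mathrm{indthin}$ (resp. $\mathrm{indpthin}$) is the same minimum when each class is additionally required to be an independent set. *)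

(* Defs.v *)
From HB Require Import structures.
From mathcomp Require Import all_boot.

Set Implicit Arguments.
Unset Strict Implicit.
Unset Printing Implicit Defensive.

Record sgraph := SGraph {
  vertex :> finType;
  adj : rel vertex;
  adj_sym : symmetric adj;
  adj_irrefl : irreflexive adj }.

Section HomProduct.
Variables G1 G2 : sgraph.

Definition hom_adj : rel (G1 * G2) :=
  fun u v => (u.1 != v.1) && (~~ adj u.1 v.1 || adj u.2 v.2).

Lemma hom_adj_sym : symmetric hom_adj.
Proof.
by move=> u v; rewrite /hom_adj eq_sym (adj_sym u.1) (adj_sym u.2).
Qed.

Lemma hom_adj_irrefl : irreflexive hom_adj.
Proof. by move=> u; rewrite /hom_adj eqxx. Qed.

Definition hom_product : sgraph := SGraph hom_adj_sym hom_adj_irrefl.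

End HomProduct.

Section Thinness.
Variable G : sgraph.

(* A duplicate-free tuple of length #|G| lists every vertex exactly once. *)
Definition is_ordering (v : #|G|.-tuple G) : bool := uniq v.

Definition same_class (P : {set {set G}}) (x y : G) : bool :=
  pblock P x == pblock P y.

Definition consistent (v : #|G|.-tuple G) (P : {set {set G}}) : bool :=
  [forall r : 'I_#|G|, forall s : 'I_#|G|, forall t : 'I_#|G|,
    [&& r < s, s < t, same_class P (tnth v r) (tnth v s)
      & adj (tnth v t) (tnth v r)] ==> adj (tnth v t) (tnth v s)].

Definition strongly_consistent (v : #|G|.-tuple G) (P : {set {set G}}) : bool :=
  consistent v P &&
  [forall r : 'I_#|G|, forall s : 'I_#|G|, forall t : 'I_#|G|,
    [&& r < s, s < t, same_class P (tnth v s) (tnth v t)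
      & adj (tnth v t) (tnth v r)] ==> adj (tnth v s) (tnth v r)].

Definition independent (A : {set G}) : bool :=
  [forall x in A, forall y in A, ~~ adj x y].

Definition thin_with (k : nat) : bool :=
  [exists P : {set {set G}}, [&& partition P [set: G], #|P| == k
    & [exists v, is_ordering v && consistent v P]]].

Definition pthin_with (k : nat) : bool :=
  [exists P : {set {set G}}, [&& partition P [set: G], #|P| == k
    & [exists v, is_ordering v && strongly_consistent v P]]].

Definition indthin_with (k : nat) : bool :=
  [exists P : {set {set G}}, [&& partition P [set: G], #|P| == k,
      [forall A in P, independent A]
    & [exists v, is_ordering v && consistent v P]]].

Definition indpthin_with (k : nat) : bool :=
  [exists P : {set {set G}}, [&& partition P [set: G], #|P| == k,
      [forall A in P, independent A]
    & [exists v, is_ordering v && strongly_consistent v P]]].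

(* The partition into singletons is strongly consistent with any ordering. *)
Lemma indpthin_with_ex : exists k, indpthin_with k.
Proof.
pose P := preim_partition (@id G) [set: G].
have partP : partition P [set: G] by apply: preim_partitionP.
have eq_class x y : same_class P x y -> x = y.
  rewrite /same_class eq_pblock ?(partition_trivIset partP) //; last first.
    by rewrite (cover_partition partP) inE.
  rewrite /P /preim_partition pblock_equivalence_partition ?inE //.
    by move/eqP.
  by split=> // /eqP->.
exists #|P|; apply/existsP; exists P; apply/and4P; split=> //.
  apply/forall_inP=> A AP; apply/forall_inP=> x xA; apply/forall_inP=> y yA.
  have tP := partition_trivIset partP.
  have -> : x = y.
    by apply: eq_class; rewrite /same_class !(def_pblock tP AP).
  by rewrite adj_irrefl.
apply/existsP; exists (enum_tuple G).
rewrite /is_ordering enum_uniq /=; apply/andP; split.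
  apply/forallP=> r; apply/forallP=> s; apply/forallP=> t.
  by apply/implyP=> /and4P[_ _ /eq_class ->].
apply/forallP=> r; apply/forallP=> s; apply/forallP=> t.
by apply/implyP=> /and4P[_ _ /eq_class ->].
Qed.

Lemma indpthin_indthin k : indpthin_with k -> indthin_with k.
Proof.
case/existsP=> P /and4P[H1 H2 H3 /existsP[v /and3P[H4 H5 _]]].
apply/existsP; exists P; apply/and4P; split=> //.
by apply/existsP; exists v; rewrite H4.
Qed.

Lemma indpthin_pthin k : indpthin_with k -> pthin_with k.
Proof.
case/existsP=> P /and4P[H1 H2 _ H4].
by apply/existsP; exists P; apply/and3P.
Qed.

Lemma indthin_thin k : indthin_with k -> thin_with k.
Proof.
case/existsP=> P /and4P[H1 H2 _ H4].
by apply/existsP; exists P; apply/and3P.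
Qed.

Lemma indthin_with_ex : exists k, indthin_with k.
Proof. by have [k /indpthin_indthin] := indpthin_with_ex; exists k. Qed.

Lemma pthin_with_ex : exists k, pthin_with k.
Proof. by have [k /indpthin_pthin] := indpthin_with_ex; exists k. Qed.

Lemma thin_with_ex : exists k, thin_with k.
Proof. by have [k /indthin_thin] := indthin_with_ex; exists k. Qed.

Definition thin : nat := ex_minn thin_with_ex.
Definition pthin : nat := ex_minn pthin_with_ex.
Definition indthin : nat := ex_minn indthin_with_ex.
Definition indpthin : nat := ex_minn indpthin_with_ex.

End Thinness.

(* Main.v *)
Require Import Defs.
From mathcomp Require Import all_boot.

(** Let [P] be a partition of [G2] into independent sets, consistent with an
    ordering [v2]. Partition [G1 * G2] into the sets [{u} x A], [A \in P], and
    order it by the [v2]-position of the second coordinate, breaking ties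
    arbitrarily. The classes are independent, since adjacent vertices of the
    hom-product differ in their first coordinate. Two distinct vertices of one
    class have distinct second coordinates, so the only triples to which
    consistency of [v2] does not apply are those where the third vertex shares
    its second coordinate with a vertex of the class; there, the adjacency
    required in [G2] would lie within a class of [P], contradicting its
    independence. Strong consistency is consistency with both the ordering and
    its reverse (reversal exchanges the roles of the first and third vertex of
    a triple), so the same argument settles it. *)

Set Implicit Arguments.
Unset Strict Implicit.
Unset Printing Implicit Defensive.

Lemma ex_minn_leq_map (P Q : pred nat) (exP : exists n, P n)
    (exQ : exists n, Q n) (f : nat -> nat) :
  (forall k, Q k -> exists2 m, m <= f k & P m) ->
  ex_minn exP <= f (ex_minn exQ).
Proof.
move=> PQ; case: (ex_minnP exQ) => k /PQ[m le_m_fk Pm] _.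
by case: ex_minnP => n _ /(_ m Pm) /leq_trans; apply.
Qed.

Lemma tnth_rev (T : Type) n (t : n.-tuple T) i :
  tnth (rev_tuple t) i = tnth t (rev_ord i).
Proof.
by have x0 := tnth t i; rewrite !(tnth_nth x0) /= nth_rev size_tuple.
Qed.

Lemma index_rev (T : eqType) (s : seq T) x :
  uniq s -> x \in s -> index x (rev s) = size s - (index x s).+1.
Proof.
move=> uniq_s xs; have ix : index x s < size s by rewrite index_mem.
have lt_size : size s - (index x s).+1 < size s.
  by rewrite ltn_subrL (leq_ltn_trans _ ix).
have nth_x : nth x (rev s) (size s - (index x s).+1) = x.
  by rewrite nth_rev // subnSK // subKn ?nth_index // ltnW.
by rewrite -{1}nth_x index_uniq ?rev_uniq ?size_rev.
Qed.

Lemma leq_card_preim_partition (T rT : finType) (f : T -> rT) (D : {set T}) :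
  #|preim_partition f D| <= #|f @: D|.
Proof.
pose fiber a := [set y in D | a == f y].
apply: leq_trans (leq_imset_card fiber _); apply/subset_leq_card/subsetP=> A.
by case/imsetP=> x Dx ->; apply: (imset_f fiber); apply: imset_f.
Qed.

Section Precedes.
Variable T : eqType.

Definition precedes (s : seq T) : rel T := fun x y => index x s < index y s.

Lemma precedes_neq s x y : precedes s x y -> x != y.
Proof. by apply: contraTneq => ->; rewrite /precedes ltnn. Qed.

Lemma precedes_total s :
  {in s &, forall x y, x != y -> precedes s x y || precedes s y x}.
Proof.
move=> x y xs ys; rewrite -neq_ltn; apply: contraNneq.
by move/(index_inj x xs ys) ->.
Qed.

Lemma precedes_rev s : uniq s ->
  {in s &, forall x y, precedes (rev s) x y = precedes s y x}.
Proof.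
move=> uniq_s x y xs ys; rewrite /precedes !index_rev //.
by rewrite ltn_sub2lE ?index_mem.
Qed.

End Precedes.

Section Refines.
Variables (T U : eqType) (f : T -> U).

Definition refines (s : seq T) (t : seq U) : Prop :=
  forall x y, precedes t (f x) (f y) -> precedes s x y.

Lemma refines_precedes s t x y : refines s t -> f x \in t -> f y \in t ->
  f x != f y -> precedes s x y -> precedes t (f x) (f y).
Proof.
move=> ref_st fx_t fy_t /(precedes_total fx_t fy_t)/orP[// | /ref_st yx xy].
by have:= ltn_trans xy yx; rewrite ltnn.
Qed.

End Refines.

Section Orderings.
Variable G : sgraph.
Implicit Types (v : #|G|.-tuple G) (P : {set {set G}}).

Lemma mem_ordering v x : is_ordering v -> x \in v.
Proof.
move=> uniq_v.
have card_v : #|v| = #|G| by rewrite (card_uniqP uniq_v) size_tuple.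
by rewrite (subset_cardP card_v (subset_predT _) x) inE.
Qed.

Lemma is_ordering_rev v : is_ordering (rev_tuple v) = is_ordering v.
Proof. exact: rev_uniq. Qed.

Lemma exists_ordering_by_rank (rank : G -> nat) :
  exists2 v, is_ordering v & forall x y, rank x < rank y -> precedes v x y.
Proof.
pose rank_le x y := rank x <= rank y; pose s := sort rank_le (enum G).
have size_s : size s == #|G| by rewrite size_sort -cardE.
have mem_s x : x \in s by rewrite mem_sort mem_enum.
exists (Tuple size_s); first by rewrite /is_ordering /= sort_uniq enum_uniq.
move=> x y; apply: contraTT; rewrite /precedes /= -!leqNgt.
apply: (sorted_leq_index (leT := rank_le)) => //.
- by move=> ? ? ?; apply: leq_trans.
- by move=> ?; apply: leqnn.
- by apply: sort_sorted => ? ?; apply: leq_total.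
Qed.

Lemma exists_tnth_ordering v x : is_ordering v ->
  exists2 i : 'I_#|G|, tnth v i = x & index x v = i.
Proof.
move=> /(mem_ordering x)/[dup] xv; rewrite -index_mem size_tuple => ix.
by exists (Ordinal ix); rewrite // (tnth_nth x) nth_index.
Qed.

Lemma index_tnth_ordering v i : is_ordering v -> index (tnth v i) v = i.
Proof.
by move=> uniq_v; rewrite (tnth_nth (tnth v i)) index_uniq ?size_tuple.
Qed.

Lemma consistentP v P : is_ordering v ->
  reflect (forall x y z, precedes v x y -> precedes v y z ->
             same_class P x y -> adj z x -> adj z y)
          (consistent v P).
Proof.
move=> ord_v; apply: (iffP 'forall_'forall_forallP) => cons_v.
  move=> x y z.
  have [r <- index_r] := exists_tnth_ordering x ord_v.
  have [s <- index_s] := exists_tnth_ordering y ord_v.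
  have [t <- index_t] := exists_tnth_ordering z ord_v.
  rewrite /precedes index_r index_s index_t => rs st same_rs adj_tr.
  by apply: (implyP (cons_v r s t)); rewrite rs st same_rs.
move=> r s t; apply/implyP=> /and4P[rs st]; apply: cons_v;
  by rewrite /precedes !index_tnth_ordering.
Qed.

Lemma strongly_consistentE v P :
  strongly_consistent v P = consistent v P && consistent (rev_tuple v) P.
Proof.
have rev_lt (i j : 'I_#|G|) : (rev_ord i < rev_ord j) = (j < i).
  by rewrite /= ltn_sub2lE.
congr (_ && _).
apply/'forall_'forall_forallP/'forall_'forall_forallP => cons_v r s t;
  apply/implyP=> /and4P[rs st same_rs adj_tr];
  move/implyP: (cons_v (rev_ord t) (rev_ord s) (rev_ord r));
  rewrite !tnth_rev ?rev_ordK in same_rs adj_tr * => adj_ts;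
  rewrite adj_sym adj_ts // !rev_lt rs st adj_sym adj_tr andbT;
  by rewrite /same_class eq_sym.
Qed.

End Orderings.

Lemma refines_rev (G H : sgraph) (f : G -> H) (v : #|G|.-tuple G)
    (w : #|H|.-tuple H) :
  is_ordering v -> is_ordering w -> refines f v w ->
  refines f (rev_tuple v) (rev_tuple w).
Proof.
move=> ord_v ord_w ref_vw x y.
by rewrite !precedes_rev ?mem_ordering //; apply: ref_vw.
Qed.

Section Classes.
Variable G : sgraph.

Lemma same_class_pblock (P : {set {set G}}) x y : partition P [set: G] ->
  same_class P x y = (y \in pblock P x).
Proof.
move=> partP; rewrite /same_class eq_pblock ?(partition_trivIset partP) //.
by rewrite (cover_partition partP) inE.
Qed.

Lemma same_class_preim_partition (rT : eqType) (f : G -> rT) x y :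
  same_class (preim_partition f [set: G]) x y = (f x == f y).
Proof.
rewrite same_class_pblock ?preim_partitionP //.
by rewrite pblock_equivalence_partition ?inE //; split=> // /eqP->.
Qed.

Lemma independent_classesP (P : {set {set G}}) : partition P [set: G] ->
  reflect (forall x y, same_class P x y -> ~~ adj x y)
          [forall A in P, independent A].
Proof.
move=> partP; have tiP := partition_trivIset partP.
have coverP x : x \in cover P by rewrite (cover_partition partP) inE.
apply: (iffP forall_inP) => [indP x y | indP A PA].
  rewrite same_class_pblock // => yx; have := indP _ (pblock_mem (coverP x)).
  by move=> /forall_inP/(_ x)/[!mem_pblock]/(_ (coverP x))/forall_inP; apply.
apply/forall_inP=> x Ax; apply/forall_inP=> y Ay; apply: indP.
by rewrite /same_class !(def_pblock tiP PA).
Qed.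

End Classes.

Section HomPartition.
Variables (G1 G2 : sgraph) (P : {set {set G2}}).
Hypothesis partP : partition P [set: G2].

Local Notation G := (hom_product G1 G2).

Definition hom_partition : {set {set G}} :=
  preim_partition (fun x : G => (x.1, pblock P x.2)) [set: G].

Lemma hom_partitionP : partition hom_partition [set: G].
Proof. exact: preim_partitionP. Qed.

Lemma same_class_hom_partition x y :
  same_class hom_partition x y = (x.1 == y.1) && same_class P x.2 y.2.
Proof. exact: same_class_preim_partition. Qed.

Lemma hom_partition_independent : [forall A in hom_partition, independent A].
Proof.
apply/(independent_classesP hom_partitionP)=> x y.
by rewrite same_class_hom_partition /= /hom_adj => /andP[-> _].
Qed.

Lemma card_hom_partition : #|hom_partition| <= #|G1| * #|P|.
Proof.
apply: leq_trans (leq_card_preim_partition _ _) _.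
rewrite -cardsT -cardsX; apply/subset_leq_card/subsetP=> _ /imsetP[x _ ->].
by rewrite !inE pblock_mem // (cover_partition partP) inE.
Qed.

Hypothesis indP : [forall A in P, independent A].

Lemma hom_partition_consistent (v2 : #|G2|.-tuple G2) (v : #|G|.-tuple G) :
  is_ordering v2 -> is_ordering v -> refines (fun x : G => x.2) v v2 ->
  consistent v2 P -> consistent v hom_partition.
Proof.
move=> ord2 ord_v ref_v /(consistentP _ ord2) cons2.
have v2_lt (x y : G) : x.2 != y.2 -> precedes v x y -> precedes v2 x.2 y.2.
  by apply: (refines_precedes ref_v); apply: mem_ordering.
apply/consistentP=> // x y z xy yz.
rewrite same_class_hom_partition => /andP[/eqP eq1 same2] /andP[neq1 adj_zx].
rewrite /= /hom_adj -eq1 neq1 /=; case/orP: adj_zx => [-> // | adj2].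
rewrite (cons2 x.2) ?orbT //; apply: v2_lt => //.
  apply: contra_neq (precedes_neq xy) => eq2.
  by rewrite [x]surjective_pairing eq1 eq2 -surjective_pairing.
apply: contraTneq adj2 => <-.
by rewrite adj_sym (independent_classesP partP indP).
Qed.

Lemma hom_partition_strongly_consistent (v2 : #|G2|.-tuple G2)
    (v : #|G|.-tuple G) :
  is_ordering v2 -> is_ordering v -> refines (fun x : G => x.2) v v2 ->
  strongly_consistent v2 P -> strongly_consistent v hom_partition.
Proof.
move=> ord2 ord_v ref_v.
rewrite !strongly_consistentE => /andP[cons2 cons2_rev].
rewrite (hom_partition_consistent ord2) //=.
apply: (hom_partition_consistent (v2 := rev_tuple v2)) cons2_rev.
- by rewrite is_ordering_rev.
- by rewrite is_ordering_rev.
- exact: refines_rev.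
Qed.

End HomPartition.

Definition independent_partition_with (G : sgraph)
    (compatible : #|G|.-tuple G -> {set {set G}} -> bool) (k : nat) : bool :=
  [exists P : {set {set G}}, [&& partition P [set: G], #|P| == k,
      [forall A in P, independent A]
    & [exists v, is_ordering v && compatible v P]]].

Lemma independent_partition_with_hom_product (G1 G2 : sgraph)
    (compatible2 : #|G2|.-tuple G2 -> {set {set G2}} -> bool)
    (compatible : #|hom_product G1 G2|.-tuple (hom_product G1 G2) ->
       {set {set hom_product G1 G2}} -> bool) k :
  (forall P, partition P [set: G2] -> [forall A in P, independent A] ->
     forall v2 v, is_ordering v2 -> is_ordering v ->
     refines (fun x : hom_product G1 G2 => x.2) v v2 ->
     compatible2 v2 P -> compatible v (hom_partition G1 P)) ->
  independent_partition_with compatible2 k ->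
  exists2 m, m <= #|G1| * k & independent_partition_with compatible m.
Proof.
move=> lift_compatible.
case/existsP=> P /and4P[partP /eqP<- indP /existsP[v2 /andP[ord2 comp2]]].
exists #|hom_partition G1 P|; first exact: card_hom_partition.
apply/existsP; exists (hom_partition G1 P).
rewrite hom_partitionP eqxx hom_partition_independent /=; apply/existsP.
have [v ord_v ref_v] :=
  exists_ordering_by_rank (fun x : hom_product G1 G2 => index x.2 v2).
by exists v; rewrite ord_v (lift_compatible _ partP indP v2).
Qed.

Lemma leq_thin_indthin (G : sgraph) : thin G <= indthin G.
Proof.
by apply: (ex_minn_leq_map _ _ (f := id)) => k /indthin_thin; exists k.
Qed.

Lemma leq_pthin_indpthin (G : sgraph) : pthin G <= indpthin G.
Proof.
by apply: (ex_minn_leq_map _ _ (f := id)) => k /indpthin_pthin; exists k.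
Qed.

Lemma leq_indthin_hom_product (G1 G2 : sgraph) :
  indthin (hom_product G1 G2) <= #|G1| * indthin G2.
Proof.
apply: (ex_minn_leq_map _ _ (f := muln #|G1|)) => k.
apply: independent_partition_with_hom_product => P.
exact: hom_partition_consistent.
Qed.

Lemma leq_indpthin_hom_product (G1 G2 : sgraph) :
  indpthin (hom_product G1 G2) <= #|G1| * indpthin G2.
Proof.
apply: (ex_minn_leq_map _ _ (f := muln #|G1|)) => k.
apply: independent_partition_with_hom_product => P.
exact: hom_partition_strongly_consistent.
Qed.

Theorem theorem4p52 (G1 G2 : sgraph) :
  (thin (hom_product G1 G2) <= indthin (hom_product G1 G2) /\
   indthin (hom_product G1 G2) <= #|G1| * indthin G2) /\
  (pthin (hom_product G1 G2) <= indpthin (hom_product G1 G2) /\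
   indpthin (hom_product G1 G2) <= #|G1| * indpthin G2).
Proof.
split; split.
- exact: leq_thin_indthin.
- exact: leq_indthin_hom_product.
- exact: leq_pthin_indpthin.
- exact: leq_indpthin_hom_product.
Qed.
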